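(* In a two-dimensional problem with reflectional symmetry, whose inflow axis is the $y$-axis, the hyperbolic ten-moment model (zero heat flux and no isotropization of the pressure tensor) does not support regular steady reconnection if $\partial_y^k (\mathbf{u}_s)_y\neq0$ at the origin for some $k$, where $\mathbf{u}_s$ is the fluid velocity of the species $s$ being modeled.
   Context: Coordinates are $(x,y,z)$. Two-dimensional means all quantities are independent of $z$ (the out-of-plane coordinate). Reflectional symmetry means that the problem is invariant under the reflection $x\mapsto-x$ and under the reflection $y\mapsto-y$ (hence under $180^\circ$ rotation about the $z$-axis), where the fluid quantities and the electric field $\mathbf{E}$ are proper tensors and the magnetic field $\mathbf{B}$ is a pseudovector: under $x\mapsto-x$ a component of a proper tensor field is odd in $x$ if it has an odd number of $x$ indices and even otherwise, while for $\mathbf{B}$ the component $B_x$ is even and $B_y,B_z$ are odd in $x$; the analogous statement holds for $y$. By convention fluid approaches the origin along the inflow ($y$) axis. Hyperbolic ten-moment model: each charged species $s$, with particle charge $q_s$ and mass $m_s$, is a gas described by its number density $n_s$ (mass density $\rho_s=m_sn_s$), velocity $\mathbf{u}_s$ and symmetric pressure tensor $\mathsf{P}_s=n_s\mathsf{T}_s$ ($\mathsf{T}_s$ is the temperature tensor), satisfying, with $d_t=\partial_t+\mathbf{u}_s\cdot\nabla$, $$\partial_t n_s+\nabla\cdot(n_s\mathbf{u}_s)=0,\qquad \rho_s\,d_t\mathbf{u}_s+\nabla\cdot\mathsf{P}_s=q_sn_s(\mathbf{E}+\mathbf{u}_s\times\mathbf{B}),$$ $$n_s\,d_t\mathsf{T}_s+\mathrm{Sym2}(\mathsf{P}_s\cdot\nabla\mathbf{u}_s)=\frac{q_s}{m_s}\,\mathrm{Sym2}(\mathsf{P}_s\times\mathbf{B}),$$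 coupled to the electromagnetic field through Maxwell's equations (or their quasineutral magnetohydrodynamic limit). Here $\mathrm{Sym2}(X)=X+X^T$, $(\mathsf{P}\cdot\nabla\mathbf{u})_{ij}=\sum_k\mathsf{P}_{ik}\partial_ku_j$ and $(\mathsf{P}\times\mathbf{B})_{ij}=\sum_{k,l}\epsilon_{jkl}\mathsf{P}_{ik}B_l$. Steady means $\partial_t=0$. The rate of reconnection is the magnitude of the out-of-plane component $E_z$ of the electric field at the origin; steady reconnection is a steady solution with nonzero rate of reconnection. A ten-moment solution is singular if its density fails to be strictly positive or its pressure tensor fails to be strictly positive definite anywhere; regular means not singular. Solutions are taken to be smooth at the origin, which is regarded as no loss of generality (by convolution with an approximate identity). *)

(* Defs.v *)
From HB Require Import structures.
From mathcomp Require Import all_boot all_order all_algebra.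
From mathcomp Require Import all_classical all_reals all_analysis.

Set Implicit Arguments.
Unset Strict Implicit.
Unset Printing Implicit Defensive.

Import Order.TTheory GRing.Theory Num.Theory.
Import numFieldNormedType.Exports.

Local Open Scope classical_set_scope.
Local Open Scope ring_scope.

Definition ix : 'I_3 := 0.
Definition iy : 'I_3 := 1.
Definition iz : 'I_3 := 2%:R.

Section Fields.
Variable R : realType.

Local Notation position := 'rV[R]_3.

(* Fields depend on time first, then on position. *)
Definition scalar_field := R -> position -> R.
Definition vector_field := R -> position -> 'rV[R]_3.
Definition tensor_field := R -> position -> 'M[R]_3.

Definition vcomp (v : vector_field) (i : 'I_3) : scalar_field :=
  fun t x => v t x 0 i.
Definition tcomp (A : tensor_field) (i j : 'I_3) : scalar_field :=
  fun t x => A t x i j.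

Definition unit_vec (k : 'I_3) : position := delta_mx 0 k.

Definition partial (k : 'I_3) (f : position -> R) : position -> R :=
  fun x => 'D_(unit_vec k) f x.

Definition partial_t (f : scalar_field) : scalar_field :=
  fun t x => 'D_1 (f^~ x) t.
Definition partial_x (k : 'I_3) (f : scalar_field) : scalar_field :=
  fun t => partial k (f t).

(* d_t = partial_t + u . grad *)
Definition convective (u : vector_field) (f : scalar_field) : scalar_field :=
  fun t x => partial_t f t x + \sum_k u t x 0 k * partial_x k f t x.

(* Addition in 'I_3 is modulo 3, so the two tests pick out the even and the odd
   permutations of the three axes. *)
Definition levi_civita (i j k : 'I_3) : R :=
  if (j == i + 1) && (k == i + 2%:R) then 1
  else if (j == i + 2%:R) && (k == i + 1) then -1
  else 0.

Definition cross (a b : 'rV[R]_3) : 'rV[R]_3 :=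
  \row_i \sum_j \sum_k levi_civita i j k * a 0 j * b 0 k.

Definition tensor_cross (A : 'M[R]_3) (b : 'rV[R]_3) : 'M[R]_3 :=
  \matrix_(i, j) \sum_k \sum_l levi_civita j k l * A i k * b 0 l.

Definition sym2 (A : 'M[R]_3) : 'M[R]_3 := A + A^T.

Definition divergence (v : vector_field) : scalar_field :=
  fun t x => \sum_k partial_x k (vcomp v k) t x.

Definition curl (v : vector_field) : vector_field := fun t x =>
  \row_i \sum_j \sum_k levi_civita i j k * partial_x j (vcomp v k) t x.

Definition tensor_divergence (A : tensor_field) : vector_field :=
  fun t x => \row_j \sum_i partial_x i (tcomp A i j) t x.

Definition tensor_dot_grad (A : tensor_field) (u : vector_field) :
  tensor_field := fun t x =>
  \matrix_(i, j) \sum_k A t x i k * partial_x k (vcomp u j) t x.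

Definition smooth_on (U : set position) (f : position -> R) :=
  forall (l : seq 'I_3) (x : position), U x ->
    {for x, continuous (foldr partial f l)} /\
    forall k, derivable (foldr partial f l) x (unit_vec k).

Definition smooth_at (a : position) (f : position -> R) :=
  exists2 U : set position, open_nbhs a U & smooth_on U f.

Definition reflection (a : 'I_3) (x : position) : position :=
  \row_i ((-1) ^+ (i == a) * x 0 i).

Record species := Species {
  particle_charge : R;
  particle_mass : R;
  charge_neq0 : particle_charge != 0;
  mass_gt0 : 0 < particle_mass }.

Record gas := Gas {
  density : scalar_field;
  velocity : vector_field;
  temperature : tensor_field }.

Definition pressure (g : gas) : tensor_field :=
  fun t x => density g t x *: temperature g t x.

Definition continuity_eq (g : gas) (t : R) (x : position) :=
  partial_t (density g) t x
    + divergence (fun t x => density g t x *: velocity g t x) t x = 0.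

Definition momentum_eq (p : species) (g : gas) (E B : vector_field)
    (t : R) (x : position) :=
  (particle_mass p * density g t x) *:
      (\row_i convective (velocity g) (vcomp (velocity g) i) t x)
    + tensor_divergence (pressure g) t x
  = (particle_charge p * density g t x)
      *: (E t x + cross (velocity g t x) (B t x)).

(* Zero heat flux and no isotropization: no further term appears. *)
Definition temperature_eq (p : species) (g : gas) (B : vector_field)
    (t : R) (x : position) :=
  density g t x *:
      (\matrix_(i, j) convective (velocity g) (tcomp (temperature g) i j) t x)
    + sym2 (tensor_dot_grad (pressure g) (velocity g) t x)
  = (particle_charge p / particle_mass p)
      *: sym2 (tensor_cross (pressure g t x) (B t x)).

Definition regular (D : set position) (g : gas) :=
  forall t x, D x -> 0 < density g t x /\
    forall v : 'rV[R]_3, v != 0 -> 0 < (v *m pressure g t x *m v^T) 0 0.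

Section Plasma.
Variable S : finType.

Record plasma := Plasma {
  gases : S -> gas;
  electric : vector_field;
  magnetic : vector_field }.

Definition charge_density (p : S -> species) (w : plasma) : scalar_field :=
  fun t x => \sum_s particle_charge (p s) * density (gases w s) t x.

Definition current_density (p : S -> species) (w : plasma) : vector_field :=
  fun t x => \sum_s (particle_charge (p s) * density (gases w s) t x)
                      *: velocity (gases w s) t x.

Definition faraday_eq (w : plasma) (t : R) (x : position) :=
  (\row_i partial_t (vcomp (magnetic w) i) t x)
    + curl (electric w) t x = 0.

Definition maxwell_eqs (mu0 eps0 : R) (p : S -> species) (w : plasma)
    (t : R) (x : position) :=
  [/\ faraday_eq w t x,
      divergence (magnetic w) t x = 0,
      curl (magnetic w) t x
        = mu0 *: current_density p w t x
          + (mu0 * eps0) *: (\row_i partial_t (vcomp (electric w) i) t x)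
    & eps0 * divergence (electric w) t x = charge_density p w t x].

(* Quasineutral limit: the displacement current and the net charge are
   neglected; the electric field is then determined through the momentum
   equations of the species. *)
Definition quasineutral_eqs (mu0 : R) (p : S -> species) (w : plasma)
    (t : R) (x : position) :=
  [/\ faraday_eq w t x,
      divergence (magnetic w) t x = 0,
      curl (magnetic w) t x = mu0 *: current_density p w t x
    & charge_density p w t x = 0].

Definition each_component (Q : scalar_field -> Prop) (w : plasma) :=
  [/\ forall s, Q (density (gases w s)),
      forall s i, Q (vcomp (velocity (gases w s)) i),
      forall s i j, Q (tcomp (temperature (gases w s)) i j),
      forall i, Q (vcomp (electric w) i)
    & forall i, Q (vcomp (magnetic w) i)].

(* The first-order derivatives occurring in the equations exist on D. *)
Definition differentiable_state (D : set position) (w : plasma) :=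
  each_component (fun f => forall t x, D x ->
    derivable (f^~ x) t 1 /\ forall k, derivable (f t) x (unit_vec k)) w.

Definition ten_moment_solution (mu0 eps0 : R) (p : S -> species)
    (D : set position) (w : plasma) :=
  [/\ differentiable_state D w,
      forall s t x, D x ->
        (temperature (gases w s) t x)^T = temperature (gases w s) t x,
      forall s t x, D x ->
        [/\ continuity_eq (gases w s) t x,
            momentum_eq (p s) (gases w s) (electric w) (magnetic w) t x
          & temperature_eq (p s) (gases w s) (magnetic w) t x]
    & (forall t x, D x -> maxwell_eqs mu0 eps0 p w t x) \/
      (forall t x, D x -> quasineutral_eqs mu0 p w t x)].

Definition smooth_at_origin (w : plasma) :=
  each_component (fun f => forall t, smooth_at 0 (f t)) w.

Definition two_dimensional (D : set position) (w : plasma) :=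
  (forall x h, D x -> D (x + h *: unit_vec iz)) /\
  each_component (fun f => forall t x h, D x ->
    f t (x + h *: unit_vec iz) = f t x) w.

Definition invariant_under_reflection (a : 'I_3) (D : set position)
    (w : plasma) :=
  (forall x, D x -> D (reflection a x)) /\
  forall t x, D x ->
  [/\ forall s, density (gases w s) t (reflection a x)
                = density (gases w s) t x,
      forall s i, velocity (gases w s) t (reflection a x) 0 i
                  = (-1) ^+ (i == a) * velocity (gases w s) t x 0 i,
      forall s i j, temperature (gases w s) t (reflection a x) i j
        = (-1) ^+ ((i == a) + (j == a))%N * temperature (gases w s) t x i j,
      forall i, electric w t (reflection a x) 0 i
                = (-1) ^+ (i == a) * electric w t x 0 i
    & forall i, magnetic w t (reflection a x) 0 i
                = (-1) ^+ (i != a) * magnetic w t x 0 i].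

Definition reflectional_symmetry (D : set position) (w : plasma) :=
  invariant_under_reflection ix D w /\ invariant_under_reflection iy D w.

Definition steady (D : set position) (w : plasma) :=
  each_component (fun f => forall (t : R) x, D x ->
    is_derive t (1 : R) (f^~ x) 0) w.

Definition reconnection_rate (w : plasma) (t : R) : R :=
  `|electric w t 0 0 iz|.

Definition steady_reconnection (D : set position) (w : plasma) :=
  steady D w /\ exists t, reconnection_rate w t != 0.

End Plasma.
End Fields.

(* Main.v *)
Require Import Defs.
From mathcomp Require Import all_boot all_order all_algebra.
From mathcomp Require Import all_classical all_reals all_analysis.
From mathcomp Require Import ring lra.
Import Order.TTheory GRing.Theory Num.Theory.
Import numFieldNormedType.Exports.
Local Open Scope classical_set_scope.
Local Open Scope ring_scope.

(** On the inflow axis the reflection [x |-> -x] kills [u_x], [T_xy], [T_xz],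
    [B_y] and [B_z].  With [u = u_y], [A = T_yy], [C = T_yz], [Z = T_zz],
    [b = q B_x / m], [v = u_z' + b] and primes for [d/dy], the steady
    temperature equations there read
      [u A' + 2 A u' = 2 b C],  [u C' + C u' + A v = b Z],  [u Z' = - 2 C v].
    Eliminating [b] and [v] gives [(u^2 (A Z - C^2))' = 0].  As [u] vanishes at
    the origin and [A Z - C^2 > 0] by positive definiteness, [u] vanishes along
    the axis near the origin, and with it all derivatives [d_y^k u_y] there. *)

(** * Derivatives along a line through the origin *)

Section LineDerivative.
Context {R : realType} {V : normedModType R}.
Implicit Types (f : V -> R) (v : V).

(** Both difference quotients are the same function of [h], so derivability and derivative pass
    together from direction [v] to the real variable. *)
Lemma line_quotient f v (y : R) :
  (fun h : R => h^-1 *: ((f \o shift (y *: v)) (h *: v) - f (y *: v))) =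
  (fun h : R => h^-1 *: (((fun z : R => f (z *: v)) \o shift y) (h *: (1 : R))
                         - f (y *: v))).
Proof.
by apply/funext => h /=; rewrite -scalerDl [h *: (1 : R)]mulr1.
Qed.

Lemma derive_line f v (y : R) :
  'D_v f (y *: v) = 'D_1 (fun z : R => f (z *: v)) y.
Proof. by rewrite /derive line_quotient. Qed.

Lemma derivable_line f v (y : R) :
  derivable f (y *: v) v -> derivable (fun z : R => f (z *: v)) y 1.
Proof. by rewrite /derivable line_quotient. Qed.

Lemma is_derive_line f v (y : R) : derivable f (y *: v) v ->
  is_derive y (1 : R) (fun z : R => f (z *: v)) ('D_v f (y *: v)).
Proof.
by move=> df; split; [exact: derivable_line | rewrite derive_line].
Qed.

(** Vanishing on the whole open interval, not just at one point, lets each iterate be differentiated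
    as a locally zero function. *)
Lemma iter_derive_line_eq0 f v (r : R) (k : nat) :
  {in `]-r, r[, forall y : R, f (y *: v) = 0} ->
  {in `]-r, r[, forall y : R, iter k (fun g => 'D_v g) f (y *: v) = 0}.
Proof.
elim: k => [//|k IHk] f0 y yr /=.
rewrite derive_line (@near_eq_derive _ _ _ _ (cst 0)) ?derive_cst//.
near=> z; apply: IHk => //.
by near: z; exact: near_in_itvoo.
Unshelve. all: by end_near.
Qed.

End LineDerivative.

Lemma is_derive0_itv_cst (R : realType) (f : R -> R) (a b : R) :
  {in `]a, b[, forall x : R, is_derive x (1 : R) f 0} ->
  {in `]a, b[ &, forall x y, f x = f y}.
Proof.
move=> f'0 x y xab yab; wlog xy : x y xab yab / x <= y.
  by move=> W; have [/W->//|/ltW/W->] := leP x y.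
have sub z : z \in `[x, y] -> z \in `]a, b[.
  move: xab yab; rewrite !in_itv/= => /andP[ax _] /andP[_ yb] /andP[xz zy].
  by rewrite (lt_le_trans ax xz) (le_lt_trans zy yb).
have [||c _] := @MVT_segment R f (cst 0) x y xy.
- by move=> z zxy; apply/f'0/sub; exact: subset_itv_oo_cc zxy.
- by apply: derivable_within_continuous => z /sub/f'0 [].
- by rewrite mul0r => /eqP; rewrite subr_eq0 => /eqP.
Qed.

(** * Components, reflections and the positive [yz] block of the temperature *)

Section Coordinates.
Context {R : realType}.
Implicit Types (i j k : 'I_3) (x : 'rV[R]_3).

Lemma sum3 (F : 'I_3 -> R) : \sum_k F k = F ix + F iy + F iz.
Proof.
rewrite !big_ord_recl big_ord0 addr0 addrA.
by congr (F _ + F _ + F _); exact/val_inj.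
Qed.

Lemma levi_civita_xyz :
  [/\ levi_civita R ix iy iz = 1, levi_civita R iy iz ix = 1,
      levi_civita R iz ix iy = 1, levi_civita R ix iz iy = -1
    & levi_civita R iy ix iz = -1 /\ levi_civita R iz iy ix = -1].
Proof. by []. Qed.

Lemma levi_civita_diag i j :
  [/\ levi_civita R i i j = 0, levi_civita R i j i = 0
    & levi_civita R i j j = 0].
Proof.
by rewrite /levi_civita; case: i => [[|[|[]]]//]; case: j => [[|[|[]]]//].
Qed.

Lemma reflection_ix_axis (y : R) :
  reflection ix (y *: unit_vec R iy) = y *: unit_vec R iy.
Proof.
apply/rowP => i; rewrite !mxE eqxx /=.
by case: eqP => [->|_]; rewrite ?expr0 ?mul1r// mulr0 mulr0.
Qed.

Lemma reflection0 i : reflection i 0 = 0 :> 'rV[R]_3.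
Proof. by apply/rowP => j; rewrite !mxE mulr0. Qed.

Lemma eq_oppr0 (a : R) : a = - a -> a = 0.
Proof. lra. Qed.

Lemma partial_iz_eq0 (f : 'rV[R]_3 -> R) x :
  (forall h, f (x + h *: unit_vec R iz) = f x) -> partial iz f x = 0.
Proof.
move=> fz; rewrite /partial /derive.
rewrite (_ : (fun h : R => _) = cst 0) ?lim_cst//.
by apply/funext => h /=; rewrite [_ + x]addrC fz subrr scaler0.
Qed.

End Coordinates.

(* On the two vectors e_y and C e_y - A e_z the quadratic form takes the values
   n A and n A (A Z - C^2). *)
Lemma regular_minor_gt0 (R : realType) (D : set 'rV[R]_3) (g : gas R) t x :
  regular D g -> D x ->
  (temperature g t x)^T = temperature g t x ->
  0 < temperature g t x iy iy * temperature g t x iz iz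
      - temperature g t x iy iz ^+ 2.
Proof.
move=> reg Dx symT; have [n0 posP] := reg t x Dx.
have TC : temperature g t x iz iy = temperature g t x iy iz.
  by rewrite -{1}symT mxE.
have quad (a b : R) : (a, b) != (0, 0) ->
    0 < temperature g t x iy iy * a ^+ 2
        + 2 * temperature g t x iy iz * a * b
        + temperature g t x iz iz * b ^+ 2.
  move=> ab.
  (* A vector in the [yz] plane sees only the [yz] block. *)
  have [v [vx vy vz]] : exists v : 'rV[R]_3,
      [/\ v 0 ix = 0, v 0 iy = a & v 0 iz = b].
    exists (a *: unit_vec R iy + b *: unit_vec R iz).
    by rewrite !mxE /= !(mulr0, mulr1, addr0, add0r).
  have vn0 : v != 0.
    apply: contraNneq ab => v0.
    by rewrite -vy -vz v0 !mxE.
  have := posP v vn0; rewrite mxE sum3 !mxE !sum3 !mxE vx vy vz TC.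
  move=> pos; rewrite -(pmulr_rgt0 _ n0); apply: lt_le_trans pos _.
  by rewrite le_eqVlt; apply/orP; left; apply/eqP; ring.
have A0 : 0 < temperature g t x iy iy.
  by have := quad 1 0; rewrite xpair_eqE oner_eq0 => /(_ isT); lra.
have := quad (temperature g t x iy iz) (- temperature g t x iy iy).
rewrite xpair_eqE oppr_eq0 (gt_eqF A0) andbF => /(_ isT) pos.
rewrite -(pmulr_rgt0 _ A0); apply: lt_le_trans pos _.
by rewrite le_eqVlt; apply/orP; left; apply/eqP; ring.
Qed.

(** * The temperature equations on the inflow axis and their invariant *)

Section InflowAxis.
Context {R : realType} {S : finType}.
Variables (mu0 eps0 : R) (p : S -> species R) (D : set 'rV[R]_3).
Variables (w : plasma R S) (s : S).
Hypotheses (solw : ten_moment_solution mu0 eps0 p D w)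
  (twod : two_dimensional D w) (reflw : reflectional_symmetry D w)
  (stw : steady D w) (regw : regular D (gases w s)).

Let q := particle_charge (p s).
Let m := particle_mass (p s).
Local Notation ey := (unit_vec R iy).
Let u t y := velocity (gases w s) t (y *: ey) 0 iy.
Let T i j t y := temperature (gases w s) t (y *: ey) i j.
Let du i t y := partial_x iy (vcomp (velocity (gases w s)) i) t (y *: ey).
Let dT i j t y := partial_x iy (tcomp (temperature (gases w s)) i j) t (y *: ey).
(** The signed gyrofrequency of the species in the field component [B_x]. *)
Let b t y := q / m * magnetic w t (y *: ey) 0 ix.

Lemma axis_temperature_eqs t y : D (y *: ey) ->
  [/\ u t y * dT iy iy t y + 2 * T iy iy t y * du iy t y
        = 2 * b t y * T iy iz t y,
      u t y * dT iy iz t y + T iy iz t y * du iy t y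
        + T iy iy t y * (du iz t y + b t y) = b t y * T iz iz t y
    & u t y * dT iz iz t y = - (2 * T iy iz t y * (du iz t y + b t y))].
Proof.
move=> Dy.
have [_ /(_ s t _ Dy) symT /(_ s t _ Dy)[_ _ eqT] _] := solw.
have [_ [_ uz Tz _ _]] := twod.
have [_ _ Tt _ _] := stw.
(* The reflection in [x] fixes every point of the axis, so a component odd in [x] equals its own
   negative there. *)
have [[_ rx] _] := reflw; have := rx t _ Dy; rewrite reflection_ix_axis.
case=> _ /(_ s) ru /(_ s) rT _ rB.
have [n0 _] := regw t _ Dy.
have u_x : velocity (gases w s) t (y *: ey) 0 ix = 0.
  by apply: eq_oppr0; rewrite {1}ru expr1 mulN1r.
have T_xy : temperature (gases w s) t (y *: ey) ix iy = 0.
  by apply: eq_oppr0; rewrite {1}rT expr1 mulN1r.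
have T_xz : temperature (gases w s) t (y *: ey) ix iz = 0.
  by apply: eq_oppr0; rewrite {1}rT expr1 mulN1r.
have B_y : magnetic w t (y *: ey) 0 iy = 0.
  by apply: eq_oppr0; rewrite {1}rB expr1 mulN1r.
have B_z : magnetic w t (y *: ey) 0 iz = 0.
  by apply: eq_oppr0; rewrite {1}rB expr1 mulN1r.
have TC i j : temperature (gases w s) t (y *: ey) i j =
    temperature (gases w s) t (y *: ey) j i.
  by rewrite -{1}symT mxE.
have T_yx : temperature (gases w s) t (y *: ey) iy ix = 0 by rewrite TC.
have T_zx : temperature (gases w s) t (y *: ey) iz ix = 0 by rewrite TC.
have dzu i : partial_x iz (vcomp (velocity (gases w s)) i) t (y *: ey) = 0.
  by apply: partial_iz_eq0 => h; exact: uz.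
have dzT i j :
    partial_x iz (tcomp (temperature (gases w s)) i j) t (y *: ey) = 0.
  by apply: partial_iz_eq0 => h; exact: Tz.
have dtT i j : partial_t (tcomp (temperature (gases w s)) i j) t (y *: ey) = 0.
  by have /@derive_val := Tt s i j t _ Dy.
have [l1 l2 l3 l4 [l5 l6]] := @levi_civita_xyz R.
have ld1 i j : levi_civita R i i j = 0 by have [] := @levi_civita_diag R i j.
have ld2 i j : levi_civita R i j i = 0 by have [] := @levi_civita_diag R i j.
have ld3 i j : levi_civita R i j j = 0 by have [] := @levi_civita_diag R i j.
have entry i j := congr1 (fun M : 'M[R]_3 => M i j) eqT.
have := (entry iy iy, entry iy iz, entry iz iz).
rewrite !(mxE, sum3) /convective !sum3 !(dzu, dzT, dtT, u_x, B_y, B_z).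
rewrite !(ld1, ld2, ld3, l1, l2, l3, l4, l5, l6) !(T_yx, T_zx) (TC iz iy).
rewrite -/q -/m => -[[eyy eyz] ezz].
rewrite /u /T /du /dT /b; split; apply: (mulfI (lt0r_neq0 n0)).
- move: eyy; lra.
- move: eyz; lra.
- move: ezz; lra.
Qed.

Lemma axis_invariant_derive0 t y : D (y *: ey) ->
  is_derive y (1 : R)
    (fun z => u t z ^+ 2 * (T iy iy t z * T iz iz t z - T iy iz t z ^+ 2)) 0.
Proof.
move=> Dy; have [eyy eyz ezz] := axis_temperature_eqs t y Dy.
have [[_ du_ dT_ _ _] _ _ _] := solw.
have Hu : is_derive y (1 : R) (u t) (du iy t y).
  by apply: is_derive_line; have [_] := du_ s iy t _ Dy; apply.
have HT i j : is_derive y (1 : R) (T i j t) (dT i j t y).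
  by apply: is_derive_line; have [_] := dT_ s i j t _ Dy; apply.
have H := is_deriveM (is_deriveX 2 Hu)
  (is_deriveB (is_deriveM (HT iy iy) (HT iz iz)) (is_deriveX 2 (HT iy iz))).
apply: (is_derive_eq H).
move/eqP: eyy; rewrite -subr_eq0 => /eqP eyy.
move/eqP: eyz; rewrite -subr_eq0 => /eqP eyz.
move/eqP: ezz; rewrite -subr_eq0 => /eqP ezz.
(* The three zeros are placeholders for the residuals of the [yy], [zz] and [yz] equations. With
   multipliers [Z], [A] and [-2 C] the terms in [b] and [v] cancel, and [u] times the rest is the
   derivative of the invariant. *)
transitivity (u t y *
    (T iz iz t y * 0 + T iy iy t y * 0 - 2 * T iy iz t y * 0)); last ring.
rewrite -{1}eyy -{1}ezz -{1}eyz /GRing.scale /= !fctE.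
ring.
Qed.

(** The invariant is constant on the segment and zero at the origin; its second factor is positive,
    so [u] must vanish. *)
Lemma axis_inflow_eq0 (r t y : R) :
  {in `]-r, r[, forall z : R, D (z *: ey)} -> y \in `]-r, r[ -> u t y = 0.
Proof.
move=> Dr yr.
have r0 : 0 \in `]-r, r[.
  by move: yr; rewrite !in_itv/= => /andP[]; lra.
have D0 : D 0 by rewrite -(scale0r ey); exact: Dr.
(* The reflection in [y] fixes the origin and reverses [u_y]. *)
have u0 : u t 0 = 0.
  have [_ [_ /(_ t _ D0)]] := reflw; rewrite reflection0 => -[_ ru _ _ _].
  by apply: eq_oppr0; rewrite /u scale0r {1}ru expr1 mulN1r.
have := is_derive0_itv_cst _ _ (-r) r
  (fun z zr => axis_invariant_derive0 t z (Dr z zr)) y 0 yr r0.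
rewrite /= u0 expr0n mul0r => /eqP; rewrite mulf_eq0 sqrf_eq0 => /orP[/eqP//|].
have [_ /(_ s t _ (Dr y yr)) symT _ _] := solw.
by rewrite gt_eqF//; exact: regular_minor_gt0 regw (Dr y yr) symT.
Qed.

End InflowAxis.

Theorem mainTheorem4 (R : realType) (S : finType) (mu0 eps0 : R)
    (p : S -> species R) (D : set 'rV[R]_3) (w : plasma R S) (s : S) :
  0 < mu0 -> 0 < eps0 ->
  open D -> D 0 ->
  ten_moment_solution mu0 eps0 p D w ->
  two_dimensional D w ->
  reflectional_symmetry D w ->
  smooth_at_origin w ->
  (exists (k : nat) (t : R),
     iter k (partial iy) (vcomp (velocity (gases w s)) iy t) 0 != 0) ->
  ~ (regular D (gases w s) /\ steady_reconnection D w).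
Proof.
move=> _ _ oD D0 solw twod reflw _ [k [t /eqP uk]] [regw [stw _]]; apply: uk.
(* As [D] is open, it contains a segment of the inflow axis around the origin. *)
have : \forall y \near (0 : R), D (y *: unit_vec R iy).
  have : {for (0 : R), continuous (fun y : R => y *: unit_vec R iy)}.
    exact: scalel_continuous.
  by apply; rewrite scale0r; exact: open_nbhs_nbhs.
(* The origin is rewritten as the point with parameter 0 on the axis, to match the statement on
   iterated derivatives along a line. *)
move=> /nbhs_ballP[r /= r0 Dr]; rewrite -(scale0r (unit_vec R iy)).
apply: (@iter_derive_line_eq0 _ _ _ _ r); last by rewrite in_itv/= oppr_lt0 r0.
move=> y yr.
apply: (axis_inflow_eq0 _ _ _ _ _ _ solw twod reflw stw regw r) => // z zr.
apply: Dr; rewrite /ball/= sub0r normrN.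
by rewrite ltr_norml; move: zr; rewrite in_itv.
Qed.
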